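(* For every $\varepsilon>0$ there is a constant $c_\varepsilon>0$ depending only on $\varepsilon$ such that the following holds. Let $p>2$, let $d_1,\dots,d_p\ge 1$ be integers, $d_{\min}=\min\{d_1,\ldots,d_p\}$, and let $\mathscr{T},\tilde{\mathscr{T}}\in\mathbb{R}^{d_1\times\cdots\times d_p}$ be two odeco tensors with decompositions $$\mathscr{T}=\sum_{k=1}^{d_{\min}}\lambda_k\,\mathbf{u}_k^{(1)}\otimes\cdots\otimes\mathbf{u}_k^{(p)},\qquad \tilde{\mathscr{T}}=\sum_{k=1}^{d_{\min}}\tilde\lambda_k\,\tilde{\mathbf{u}}_k^{(1)}\otimes\cdots\otimes\tilde{\mathbf{u}}_k^{(p)},$$ where $\lambda_1\ge\cdots\ge\lambda_{d_{\min}}\ge 0$, $\tilde\lambda_1\ge\cdots\ge\tilde\lambda_{d_{\min}}\ge0$, and for each $q$ the vectors $\mathbf{u}_1^{(q)},\ldots,\mathbf{u}_{d_{\min}}^{(q)}\in\mathbb{R}^{d_q}$ are orthonormal, and likewise $\tilde{\mathbf{u}}_1^{(q)},\ldots,\tilde{\mathbf{u}}_{d_{\min}}^{(q)}\in\mathbb{R}^{d_q}$ are orthonormal. Then there exists a permutation $\pi$ of $\{1,\ldots,d_{\min}\}$ such that for any $\varepsilon>0$ and any $k\in\{1,\ldots,d_{\min}\}$ with $\|\tilde{\mathscr{T}}-\mathscr{T}\|\le c_\varepsilon\lambda_k$, $$|\lambda_k-\tilde\lambda_{\pi(k)}|\le\|\tilde{\mathscr{T}}-\mathscr{T}\|$$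 and $$\max_{1\le q\le p}\sin\angle(\mathbf{u}_k^{(q)},\tilde{\mathbf{u}}_{\pi(k)}^{(q)})\le\frac{(1+\varepsilon)\|\tilde{\mathscr{T}}-\mathscr{T}\|}{\lambda_k}.$$
   Context: A tensor $\mathscr{T}\in\mathbb{R}^{d_1\times\cdots\times d_p}$ is odeco (orthogonally decomposable) if it admits a decomposition of the form displayed in the claim. For vectors $\mathbf{u},\mathbf{v}$, $\angle(\mathbf{u},\mathbf{v})\in[0,\pi/2]$ denotes the angle between the lines they span, so for unit vectors $\sin\angle(\mathbf{u},\mathbf{v})=\sqrt{1-\langle\mathbf{u},\mathbf{v}\rangle^2}$. The spectral norm of a tensor $\mathscr{A}\in\mathbb{R}^{d_1\times\cdots\times d_p}$ is $\|\mathscr{A}\|=\max\langle\mathscr{A},\mathbf{x}^{(1)}\otimes\cdots\otimes\mathbf{x}^{(p)}\rangle$, the maximum being over unit vectors $\mathbf{x}^{(q)}\in\mathbb{R}^{d_q}$, where $\langle\cdot,\cdot\rangle$ is the entrywise inner product. Convention: $1/0=+\infty$, so when $\lambda_k=0$ the second inequality imposes nothing. *)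

(* Defs.v *)
From HB Require Import structures.
From mathcomp Require Import all_boot all_order all_algebra perm.
From mathcomp Require Import all_classical all_reals all_analysis.
From mathcomp Require Import ring lra.
Set Implicit Arguments.
Unset Strict Implicit.
Unset Printing Implicit Defensive.
Import Order.TTheory GRing.Theory Num.Theory.
Local Open Scope classical_set_scope.
Local Open Scope ring_scope.

Definition dot (R : realType) (n : nat) (u v : 'rV[R]_n) : R :=
  \sum_(i < n) u 0 i * v 0 i.

Definition enorm (R : realType) (n : nat) (u : 'rV[R]_n) : R :=
  Num.sqrt (dot u u).

(* The angle, in [0, pi / 2], between the lines spanned by nonzero u and v. *)
Definition line_angle (R : realType) (n : nat) (u v : 'rV[R]_n) : R :=
  acos (`|dot u v| / (enorm u * enorm v)).

(* Entries are addressed by dependent multi-indices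
   i = (i_1, ..., i_p) with i_q in {0, ..., d_q - 1}. *)
Notation multi_index d := {dffun forall q, 'I_(d q)}.
Notation tensor R d := {ffun multi_index d -> R}.

Definition tdot (R : realType) (p : nat) (d : 'I_p -> nat)
    (A B : tensor R d) : R :=
  \sum_(i : multi_index d) A i * B i.

Definition outer (R : realType) (p : nat) (d : 'I_p -> nat)
    (x : forall q : 'I_p, 'rV[R]_(d q)) : tensor R d :=
  [ffun i : multi_index d => \prod_(q < p) x q 0 (i q)].

(* When all the d q are positive, the set is the image of a nonempty compact
   set under a continuous map, so its supremum is a maximum. *)
Definition spectral_norm (R : realType) (p : nat) (d : 'I_p -> nat)
    (A : tensor R d) : R :=
  sup [set r | exists2 x : forall q : 'I_p, 'rV[R]_(d q),
         forall q, enorm (x q) = 1 & r = tdot A (outer x)].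

(* minn has no neutral element; for p > 0, starting from the maximum of the
   d q gives their minimum (lemmas dmin_leq and dmin_attained). *)
Definition dmin (p : nat) (d : 'I_p -> nat) : nat :=
  \big[minn / \max_(r < p) d r]_(q < p) d q.

Lemma dmin_leq (p : nat) (d : 'I_p -> nat) (q : 'I_p) : (dmin d <= d q)%N.
Proof.
rewrite /dmin; move: (\max_(r < p) d r) (mem_index_enum q) => m.
elim: (index_enum _) => // a r IH; rewrite inE big_cons geq_min.
by case/predU1P => [<-|/IH ->]; rewrite ?leqnn ?orbT.
Qed.

Lemma dmin_attained (p : nat) (d : 'I_p -> nat) :
  (0 < p)%N -> exists q : 'I_p, dmin d = d q.
Proof.
move=> p0; rewrite /dmin.
elim/big_ind: _ => [|x y [i ->] [j ->]|i _]; last by exists i.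
- have [|i e] := @bigop.eq_bigmax _ d; first by rewrite card_ord.
  by exists i; rewrite -e.
- by rewrite /minn; case: ifP => _; [exists i|exists j].
Qed.

Definition orthonormal (R : realType) (n m : nat) (v : 'I_m -> 'rV[R]_n) : Prop :=
  forall j k : 'I_m, dot (v j) (v k) = (j == k)%:R.

Definition odeco_decomposition (R : realType) (p : nat) (d : 'I_p -> nat)
    (T : tensor R d) (lambda : 'I_(dmin d) -> R)
    (u : forall q : 'I_p, 'I_(dmin d) -> 'rV[R]_(d q)) : Prop :=
  [/\ forall j k : 'I_(dmin d), (j <= k)%N -> lambda k <= lambda j,
      forall k, 0 <= lambda k,
      forall q, orthonormal (u q)
    & T = \sum_(k < dmin d) lambda k *: (outer (fun q => u q k) : tensor R d)].

Lemma sin_line_angle (R : realType) (n : nat) (u v : 'rV[R]_n) :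
  enorm u = 1 -> enorm v = 1 ->
  sin (line_angle u v) = Num.sqrt (1 - dot u v ^+ 2).
Proof.
move=> u1 v1.
have unit_dot (w : 'rV[R]_n) : enorm w = 1 -> dot w w = 1.
  move=> w1; rewrite -[LHS]sqr_sqrtr ?[Num.sqrt _]w1 ?expr1n //.
  by apply: sumr_ge0 => i _; rewrite -expr2 sqr_ge0.
have dot_le1 (s : R) : s ^+ 2 = 1 -> s * dot u v <= 1.
  move=> s1.
  have h : 0 <= \sum_(i < n) (u 0 i - s * v 0 i) ^+ 2.
    by apply: sumr_ge0 => i _; rewrite sqr_ge0.
  have e : \sum_(i < n) (u 0 i - s * v 0 i) ^+ 2
      = dot u u + s ^+ 2 * dot v v - 2 * (s * dot u v).
    rewrite /dot !mulr_sumr -big_split -sumrB /=; apply: eq_bigr => i _; ring.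
  by move: h; rewrite e !unit_dot // s1; lra.
have h : `|dot u v| <= 1.
  rewrite ler_norml -[dot u v]mul1r dot_le1 ?expr1n // andbT lerNl.
  by rewrite mul1r -mulN1r dot_le1 ?sqrrN ?expr1n.
rewrite /line_angle u1 v1 mulr1 divr1 sin_acos ?h ?andbT.
  by rewrite real_normK // num_real.
by rewrite (le_trans _ (normr_ge0 _)) // lerN10.
Qed.

(* Main.v *)
Require Import Defs.
From HB Require Import structures.
From mathcomp Require Import all_boot all_order all_algebra perm.
From mathcomp Require Import all_classical all_reals all_analysis.
From mathcomp Require Import ring lra zify.
Set Implicit Arguments.
Unset Strict Implicit.
Unset Printing Implicit Defensive.
Import Order.TTheory GRing.Theory Num.Theory.
Local Open Scope ring_scope.

(* Write delta for the spectral norm of T' - T and A_q(k, j) for the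
   overlap <u_k^(q), u'_j^(q)>.  Evaluating T' - T at u_k in all modes but q and
   at u'_j in mode q (and with the roles exchanged) gives
     | lambda_k A_q - lambda'_j prod_(r != q) A_r | <= delta,
     | lambda'_j A_q - lambda_k prod_(r != q) A_r | <= delta.
   As p > 2, the product has at least two factors, so the largest overlap t of a
   pair satisfies lambda_k t (1 - t) <= delta: it is near 0 or near 1.  Evaluating
   at u_k in all modes shows that not all j have small overlaps; the j with a
   large one is unique by Bessel's inequality, all its overlaps are near 1, and
   lambda'_j is near lambda_k.
   For i != j, the same relations bound lambda'_i |A_q(k, i)| by a small multiple
   of lambda_k, and the sum over i of the products of two further overlaps is at
   most quadratic in the sines.  In the evaluation at (u_k, ..., u_k) these terms
   are therefore absorbed by the loss 1 - A_r A_s in the j-th term, which gives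
   |lambda_k - lambda'_j| <= delta with constant 1; evaluating at the component
   of u_k^(q) orthogonal to u'_j^(q), for the q with the largest sine s, gives
   (1 - O(delta / lambda_k)) lambda_k s <= delta. *)

(** * Extending a partial injection to a permutation *)

Lemma inj_in_extend_perm (T : finType) (f : T -> T) (D : seq T) :
  {in D &, injective f} -> exists s : {perm T}, {in D, s =1 f}.
Proof.
elim: D => [|x D IH] finj; first by exists 1%g.
have [|s sf] := IH.
  by move=> y z yD zD; apply: finj; rewrite inE ?yD ?zD orbT.
have [xD|xD] := boolP (x \in D).
  by exists s => y; rewrite inE => /predU1P [->|]; apply: sf.
(* The transposition sends [s x] to [f x] and fixes [s y = f y] for [y] in [D], by injectivity of
   [s] and of [f]. *)
exists (s * tperm (s x) (f x))%g => y; rewrite inE permM => /predU1P [->|yD].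
  by rewrite tpermL.
have xy : x != y by apply: contraNneq xD => ->.
rewrite tpermD; first exact: sf.
  by rewrite (inj_eq perm_inj).
by rewrite sf //; apply: contraNneq xy => /finj -> //;
  rewrite inE ?eqxx ?yD ?orbT.
Qed.

(** * The Euclidean inner product *)

Section Dot.
Variables (R : realType) (n : nat).
Implicit Types u v w : 'rV[R]_n.

Lemma dotC u v : dot u v = dot v u.
Proof. by apply: eq_bigr => i _; rewrite mulrC. Qed.

Lemma dotDr u v w : dot u (v + w) = dot u v + dot u w.
Proof. by rewrite -big_split; apply: eq_bigr => i _; rewrite mxE mulrDr. Qed.

Lemma dotZr (a : R) u v : dot u (a *: v) = a * dot u v.
Proof. by rewrite mulr_sumr; apply: eq_bigr => i _; rewrite mxE mulrCA. Qed.

Lemma dotBr u v w : dot u (v - w) = dot u v - dot u w.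
Proof. by rewrite dotDr -scaleN1r dotZr mulN1r. Qed.

Lemma dotBl u v w : dot (u - v) w = dot u w - dot v w.
Proof. by rewrite !(dotC _ w) dotBr. Qed.

Lemma dotZl (a : R) u v : dot (a *: u) v = a * dot u v.
Proof. by rewrite dotC dotZr dotC. Qed.

Lemma dot0r u : dot u 0 = 0.
Proof. by rewrite -(scale0r 0) dotZr mul0r. Qed.

Lemma dot_sumr (I : finType) u (F : I -> 'rV[R]_n) :
  dot u (\sum_i F i) = \sum_i dot u (F i).
Proof.
by elim/big_ind2: _ => [|x a y b <- <-|//]; rewrite ?dot0r ?dotDr.
Qed.

Lemma dot_ge0 u : 0 <= dot u u.
Proof. by apply: sumr_ge0 => i _; rewrite -expr2 sqr_ge0. Qed.

Lemma enorm_sqr u : enorm u ^+ 2 = dot u u.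
Proof. by rewrite sqr_sqrtr ?dot_ge0. Qed.

Lemma enorm1P u : enorm u = 1 <-> dot u u = 1.
Proof.
split=> [u1|u1]; first by rewrite -enorm_sqr u1 expr1n.
by rewrite /enorm u1 sqrtr1.
Qed.

Lemma enorm_eq0 u : enorm u = 0 -> u = 0.
Proof.
move=> u0; have uu0 : dot u u = 0 by rewrite -enorm_sqr u0 expr0n.
apply/rowP => i; rewrite mxE; apply/eqP; rewrite -sqrf_eq0 expr2.
move/eqP: uu0; rewrite psumr_eq0 => [/allP/(_ i)|j _].
  by rewrite mem_index_enum => /(_ isT).
by rewrite -expr2 sqr_ge0.
Qed.

(** The residual of [w] after projection onto the span of the [v j] has nonnegative squared norm. *)
Lemma bessel (m : nat) (v : 'I_m -> 'rV[R]_n) w :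
  Defs.orthonormal v -> \sum_j dot (v j) w ^+ 2 <= dot w w.
Proof.
move=> von; have := dot_ge0 (w - \sum_j dot (v j) w *: v j).
set s := \sum_j _ *: _.
have vs j : dot (v j) s = dot (v j) w.
  rewrite dot_sumr (bigD1 j) //= big1 ?addr0 => [|i ij].
    by rewrite dotZr von eqxx mulr1.
  by rewrite dotZr von eq_sym (negPf ij) mulr0.
have ws : dot w s = \sum_j dot (v j) w ^+ 2.
  by rewrite dot_sumr; apply: eq_bigr => j _; rewrite dotZr (dotC w) expr2.
have ss : dot s s = \sum_j dot (v j) w ^+ 2.
  rewrite {2}/s dot_sumr; apply: eq_bigr => j _.
  by rewrite dotZr (dotC s) vs expr2.
by rewrite dotBr !dotBl (dotC s w) ws ss; lra.
Qed.

End Dot.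

(** * Rank-one tensors and the spectral norm *)

Section Tensor.
Variables (R : realType) (p : nat) (d : 'I_p -> nat).

(** Distributivity with index ranges depending on [q]; it turns pairings of rank-one tensors into
    products of inner products. *)
Lemma sum_dffun_prod (P : forall q : 'I_p, 'I_(d q) -> R) :
  \sum_(i : multi_index d) \prod_q P q (i q) = \prod_q \sum_i P q i.
Proof.
rewrite (reindex (@dffun_of_fprod _ (fun q => 'I_(d q)))) /=; last first.
  exact/onW_bij/dffun_of_fprod_bij.
under eq_bigr => t _ do under eq_bigr => q _ do
  rewrite ffunE -[P q _](ffunE (fun i => P q i)).
rewrite (big_fprod 1 +%R (fun q => [ffun i => P q i])).
under [RHS]eq_bigr => q _ do rewrite (big_tag (fun q i => P q i)).
rewrite (bigA_distr_big_dep (fun q => tagged_with _ q)) /=.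
apply: eq_bigr => g _; apply: eq_bigr => q _.
by rewrite /untag; case: eqP => // e; rewrite ffunE.
Qed.

Lemma tdot_outer (u x : forall q : 'I_p, 'rV[R]_(d q)) :
  tdot (outer u) (outer x) = \prod_q dot (u q) (x q).
Proof.
rewrite /dot -sum_dffun_prod; apply: eq_bigr => i _.
by rewrite !ffunE -big_split.
Qed.

Lemma tdot_sum_outer (m : nat) (lambda : 'I_m -> R)
    (u : forall q : 'I_p, 'I_m -> 'rV[R]_(d q))
    (x : forall q : 'I_p, 'rV[R]_(d q)) :
  tdot (\sum_k lambda k *: (outer (fun q => u q k) : tensor R d)) (outer x) =
  \sum_k lambda k * \prod_q dot (u q k) (x q).
Proof.
under [RHS]eq_bigr => k _ do rewrite -tdot_outer mulr_sumr.
rewrite exchange_big; apply: eq_bigr => i _ /=.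
by rewrite sum_ffunE mulr_suml; apply: eq_bigr => k _; rewrite ffunE mulrA.
Qed.

Lemma tdotBl (A B C : tensor R d) : tdot (A - B) C = tdot A C - tdot B C.
Proof.
by rewrite -sumrB; apply: eq_bigr => i _; rewrite !ffunE mulrBl.
Qed.

(** The supremum is over a bounded set: unit vectors have coordinates of absolute value at most 1,
    so the sum of all [|A i|] is an upper bound. *)
Lemma tdot_le_spectral_norm (A : tensor R d)
    (x : forall q : 'I_p, 'rV[R]_(d q)) :
  (forall q, enorm (x q) = 1) -> tdot A (outer x) <= spectral_norm A.
Proof.
move=> x1; apply: ub_le_sup; last by exists x.
exists (\sum_i `|A i|) => _ [y y1 ->]; apply: ler_sum => i _.
apply: le_trans (ler_norm _) _; rewrite normrM ler_piMr // ffunE normr_prod.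
apply: prodr_ile1 => q _; rewrite normr_ge0 /=.
have : y q 0 (i q) ^+ 2 <= 1.
  have /enorm1P <- := y1 q.
  rewrite /dot (bigD1 (i q)) //= expr2 lerDl sumr_ge0 // => j _.
  by rewrite -expr2 sqr_ge0.
by rewrite -(real_normK (num_real _)) expr_le1.
Qed.

(** Negating the vector in a single mode changes the sign of the pairing. *)
Lemma abs_tdot_le_spectral_norm (A : tensor R d)
    (x : forall q : 'I_p, 'rV[R]_(d q)) :
  (0 < p)%N -> (forall q, enorm (x q) = 1) ->
  `|tdot A (outer x)| <= spectral_norm A.
Proof.
move=> p0 x1; rewrite ler_norml tdot_le_spectral_norm // andbT lerNl.
pose q0 := Ordinal p0.
have -> : - tdot A (outer x) =
    tdot A (outer (fun q => (if q == q0 then -1 else 1) *: x q)).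
  rewrite -(mulN1r (tdot _ _)) mulr_sumr; apply: eq_bigr => i _; rewrite mulrCA; congr (_ * _).
  rewrite !ffunE (bigD1 q0) //= [in RHS](bigD1 q0) //= mxE mulrA; congr (_ * _).
  by apply: eq_bigr => q /negPf ->; rewrite scale1r.
apply: tdot_le_spectral_norm => q; apply/enorm1P.
by rewrite dotZr dotZl; have /enorm1P -> := x1 q; case: ifP => _; ring.
Qed.

End Tensor.

(** * Products of overlaps over several modes *)

Section Products.
Variables (R : realType) (p m : nat).

Lemma two_other_modes (q : 'I_p) : (2 < p)%N ->
  exists r s : 'I_p, [/\ r != q, s != q & s != r].
Proof.
move=> p2; have : (1 < #|[set~ q]|)%N by rewrite cardsC1 card_ord; lia.
case/card_gt1P => r [s [rq sq rs]]; exists r, s.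
by rewrite !inE in rq sq; split; rewrite // eq_sym.
Qed.

Lemma prod_le_factor (a : 'I_p -> R) (P : pred 'I_p) r :
  (forall q, `|a q| <= 1) -> P r -> `|\prod_(q | P q) a q| <= `|a r|.
Proof.
move=> a1 Pr; rewrite normr_prod (bigD1 r) //= ler_piMr //.
by apply: prodr_ile1 => q _; rewrite normr_ge0 a1.
Qed.

Lemma prod_le_factor2 (a : 'I_p -> R) (P : pred 'I_p) r s :
  (forall q, `|a q| <= 1) -> P r -> P s -> s != r ->
  `|\prod_(q | P q) a q| <= `|a r| * `|a s|.
Proof.
move=> a1 Pr Ps sr; rewrite normr_prod (bigD1 r) //= ler_wpM2l //.
by rewrite -normr_prod prod_le_factor ?Ps.
Qed.

(* One factor absorbs the weight into M; AM-GM applies to two further ones. *)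
Lemma weighted_prod_sum_le (a : 'I_p -> 'I_m -> R) (l : 'I_m -> R)
    (P : pred 'I_m) (M : R) (r s : 'I_p) :
  (2 < p)%N -> (forall j, 0 <= l j) -> 0 <= M ->
  (forall q j, `|a q j| <= 1) ->
  (forall q j, P j -> l j * `|a q j| <= M) -> s != r ->
  \sum_(j | P j) l j * `|\prod_q a q j| <=
  M * ((\sum_(j | P j) a r j ^+ 2 + \sum_(j | P j) a s j ^+ 2) / 2).
Proof.
move=> p2 l0 M0 a1 aM sr; rewrite -big_split mulr_suml mulr_sumr /=.
apply: ler_sum => j Pj.
have : (0 < #|~: [set r; s]|)%N.
  by have := cardsC [set r; s]; rewrite cards2 card_ord; lia.
case/card_gt0P => t; rewrite !inE negb_or => /andP [tr ts].
rewrite normr_prod (bigD1 t) //= [leLHS]mulrA.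
apply: le_trans (_ : M * (`|a r j| * `|a s j|) <= _).
  apply: ler_pM; rewrite ?mulr_ge0 ?prodr_ge0 ?aM //.
  by rewrite -normr_prod prod_le_factor2 // eq_sym.
rewrite ler_wpM2l // -(real_normK (num_real (a r j))).
rewrite -(real_normK (num_real (a s j))).
have := sqr_ge0 (`|a r j| - `|a s j|); nra.
Qed.

End Products.

(* For decompositions of T and T', this says that T' - T has spectral norm at
   most delta (odeco_close_forms); it is symmetric in the two decompositions. *)
Definition close_forms (R : realType) (p : nat) (d : 'I_p -> nat) (m : nat)
    (lambda lambda' : 'I_m -> R)
    (u u' : forall q : 'I_p, 'I_m -> 'rV[R]_(d q)) (delta : R) : Prop :=
  forall x : forall q : 'I_p, 'rV[R]_(d q), (forall q, enorm (x q) = 1) ->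
  `|\sum_k lambda k * \prod_q dot (u q k) (x q)
    - \sum_j lambda' j * \prod_q dot (u' q j) (x q)| <= delta.

Lemma close_formsC (R : realType) (p : nat) (d : 'I_p -> nat) (m : nat)
    (lambda lambda' : 'I_m -> R)
    (u u' : forall q : 'I_p, 'I_m -> 'rV[R]_(d q)) (delta : R) :
  close_forms lambda lambda' u u' delta -> close_forms lambda' lambda u' u delta.
Proof. by move=> h x x1; rewrite distrC h. Qed.

(** * Relations obtained by contracting against one component *)

Section Contraction.
Variables (R : realType) (p : nat) (d : 'I_p -> nat) (m : nat).
Variables (lambda lambda' : 'I_m -> R).
Variables (u u' : forall q : 'I_p, 'I_m -> 'rV[R]_(d q)) (delta : R).
Hypothesis p2 : (2 < p)%N.
Hypothesis uon : forall q, Defs.orthonormal (u q).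
Hypothesis u'on : forall q, Defs.orthonormal (u' q).
Hypothesis lambda0 : forall k, 0 <= lambda k.
Hypothesis lambda'0 : forall j, 0 <= lambda' j.
Hypothesis close : close_forms lambda lambda' u u' delta.

Let A q k j := dot (u q k) (u' q j).

Lemma close_ge0 : 'I_m -> 0 <= delta.
Proof.
move=> k; apply: le_trans (normr_ge0 _) (close (x := fun q => u q k) _) => q.
by apply/enorm1P; rewrite uon eqxx.
Qed.

Lemma sum_overlap_le1 q k : \sum_j A q k j ^+ 2 <= 1.
Proof.
apply: le_trans (_ : dot (u q k) (u q k) <= 1); last by rewrite uon eqxx.
by under eq_bigr do rewrite /A dotC; apply: bessel.
Qed.

Lemma sum_other_overlaps_le q k j :
  \sum_(i | i != j) A q k i ^+ 2 <= 1 - A q k j ^+ 2.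
Proof. by have := sum_overlap_le1 q k; rewrite (bigD1 j) //=; lra. Qed.

Lemma sqr_overlap_le1 q k j : A q k j ^+ 2 <= 1.
Proof.
have : 0 <= \sum_(i | i != j) A q k i ^+ 2 by apply: sumr_ge0 => *; apply: sqr_ge0.
by have := sum_other_overlaps_le q k j; lra.
Qed.

Lemma abs_overlap_le1 q k j : `|A q k j| <= 1.
Proof.
by have := sqr_overlap_le1 q k j; rewrite -(real_normK (num_real _)) expr_le1.
Qed.

(** Test with [u r k] in each mode [r != q] and the normalized [y] in mode [q]. Since a mode other
    than [q] exists, orthonormality leaves only the [k]-th term of the first form. The free choice
    of [y] yields the next three relations. *)
Lemma contraction_le k q (y : 'rV[R]_(d q)) :
  `|lambda k * dot (u q k) y
    - \sum_j lambda' j * (\prod_(r | r != q) A r k j) * dot (u' q j) y|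
  <= delta * enorm y.
Proof.
have [y0|y0] := eqVneq (enorm y) 0.
  rewrite (enorm_eq0 y0) dot0r mulr0 big1 => [|j _]; last by rewrite dot0r mulr0.
  by rewrite subr0 normr0 -(enorm_eq0 y0) y0 mulr0.
have ypos : 0 < enorm y by rewrite lt_def y0 sqrtr_ge0.
pose x := eqtype.dfwith (fun r => u r k) ((enorm y)^-1 *: y).
have x1 r : enorm (x r) = 1.
  apply/enorm1P; rewrite /x; have [<-|qr] := eqVneq q r.
    by rewrite dfwith_in dotZl dotZr -enorm_sqr expr2; field.
  by rewrite dfwith_out // uon eqxx.
have prodE (w : forall r : 'I_p, 'I_m -> 'rV[R]_(d r)) i :
    \prod_r dot (w r i) (x r) =
    (enorm y)^-1 * (dot (w q i) y * \prod_(r | r != q) dot (u r k) (w r i)).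
  rewrite (bigD1 q) //= /x dfwith_in dotZr mulrA; congr (_ * _).
  by apply: eq_bigr => r rq; rewrite dfwith_out 1?eq_sym // dotC.
have [r0 [_ [r0q _ _]]] := two_other_modes q p2.
have := close x1; rewrite (bigD1 k) //= [X in _ + X - _]big1 => [|i ik]; last first.
  rewrite prodE (bigD1 r0) //= uon eq_sym (negPf ik).
  by rewrite !(mul0r, mulr0).
rewrite addr0 prodE big1 => [|r _]; last by rewrite uon eqxx.
under eq_bigr do rewrite prodE mulrCA.
rewrite mulr1 mulrCA -mulr_sumr -mulrBr normrM normfV (ger0_norm (ltW ypos)).
rewrite ler_pdivrMl // [leRHS]mulrC; congr (`|_ - _| <= _).
by apply: eq_bigr => j _; rewrite -/(A _ _ _); ring.
Qed.

Lemma overlap_relation k j q :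
  `|lambda k * A q k j - lambda' j * \prod_(r | r != q) A r k j| <= delta.
Proof.
have := contraction_le k (u' q j).
rewrite (bigD1 j) //= [X in _ - (_ + X)]big1 => [|i ij]; last first.
  by rewrite u'on (negPf ij) mulr0.
have /enorm1P -> : dot (u' q j) (u' q j) = 1 by rewrite u'on eqxx.
by rewrite u'on eqxx !mulr1 addr0.
Qed.

Lemma weight_relation k :
  `|lambda k - \sum_j lambda' j * \prod_r A r k j| <= delta.
Proof.
pose q : 'I_p := Ordinal (ltn_trans (isT : 0 < 2)%N p2).
have := contraction_le k (u q k).
have /enorm1P -> : dot (u q k) (u q k) = 1 by rewrite uon eqxx.
rewrite uon eqxx !mulr1; congr (`|_ - _| <= _); apply: eq_bigr => j _.
by rewrite [in RHS](bigD1 q) //= dotC -/(A _ _ _); ring.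
Qed.

(** Take for [y] the component of [u q k] orthogonal to [u' q j]: its norm is the sine, its inner
    product with [u q k] is the squared sine, and the [j]-th term of the second form vanishes. *)
Lemma sine_relation k j q :
  lambda k * (1 - A q k j ^+ 2) <= delta * Num.sqrt (1 - A q k j ^+ 2)
    + \sum_(i | i != j) lambda' i * `|\prod_r A r k i|.
Proof.
pose y := u q k - A q k j *: u' q j.
have uy : dot (u q k) y = 1 - A q k j ^+ 2.
  by rewrite /y dotBr dotZr uon eqxx expr2.
have u'y i : dot (u' q i) y = A q k i - A q k j * (i == j)%:R.
  by rewrite /y dotBr dotZr u'on dotC.
have yE : enorm y = Num.sqrt (1 - A q k j ^+ 2).
  rewrite /enorm; congr Num.sqrt.
  by rewrite {1}/y dotBl dotZl uy u'y eqxx mulr1 subrr mulr0 subr0.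
have := contraction_le k y; rewrite uy yE (bigD1 j) //= u'y eqxx mulr1 subrr.
rewrite mulr0 add0r; set S := (X in `|_ - X|) => h.
have {}h : lambda k * (1 - A q k j ^+ 2) <=
    delta * Num.sqrt (1 - A q k j ^+ 2) + `|S|.
  rewrite -lerBlDr; apply: le_trans h; apply: le_trans (ler_norm _).
  by rewrite lerB // ler_norm.
apply: le_trans h _.
rewrite lerD2l; apply: le_trans (ler_norm_sum _ _ _) _; apply: ler_sum => i ij.
rewrite u'y (negPf ij) mulr0 subr0 -mulrA normrM ger0_norm //.
by rewrite [in leRHS](bigD1 q) //= mulrC [in leRHS]mulrC (mulrC (A _ _ _)).
Qed.

Lemma overlap_relation_abs k j q :
  lambda k * `|A q k j| <= delta + lambda' j * `|\prod_(r | r != q) A r k j|.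
Proof.
rewrite -lerBlDr -(ger0_norm (lambda0 k)) -(ger0_norm (lambda'0 j)) -!normrM.
by apply: le_trans (overlap_relation k j q); apply: lerB_dist.
Qed.

(** For two modes [r] and [s], the [j]-th term is at most [lambda' j] times the mean of the squared
    overlaps, and by Bessel the other terms total at most [lambda' j] times the complement of that
    mean. The sum is thus at most [lambda' j], with no loss. *)
Lemma weight_le k j :
  (forall i q, i != j -> lambda' i * `|A q k i| <= lambda' j) ->
  lambda k <= delta + lambda' j.
Proof.
move=> off; pose r : 'I_p := Ordinal (ltn_trans (isT : 0 < 2)%N p2).
have [s [_ [sr _ _]]] := two_other_modes r p2.
have sums := @weighted_prod_sum_le _ _ _ (fun q i => A q k i) lambda'
  (fun i => i != j) (lambda' j) r s p2 lambda'0 (lambda'0 j)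
  (fun q => abs_overlap_le1 q k) (fun q i => off i q) sr.
have h := le_trans (ler_norm _) (weight_relation k).
have hj : lambda' j * \prod_q A q k j <=
    lambda' j * ((A r k j ^+ 2 + A s k j ^+ 2) / 2).
  rewrite ler_wpM2l //; apply: le_trans (ler_norm _) _.
  apply: le_trans (prod_le_factor2 (P := xpredT)
    (fun q => abs_overlap_le1 q k j) isT isT sr) _.
  rewrite -(real_normK (num_real (A r k j))) -(real_normK (num_real (A s k j))).
  by have := sqr_ge0 (`|A r k j| - `|A s k j|); nra.
have hi : \sum_(i | i != j) lambda' i * \prod_q A q k i <=
    \sum_(i | i != j) lambda' i * `|\prod_q A q k i|.
  by apply: ler_sum => i _; rewrite ler_wpM2l // ler_norm.
have sum_le : lambda' j * ((\sum_(i | i != j) A r k i ^+ 2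
    + \sum_(i | i != j) A s k i ^+ 2) / 2) <=
    lambda' j * ((1 - A r k j ^+ 2 + (1 - A s k j ^+ 2)) / 2).
  by rewrite ler_wpM2l // ler_pM2r ?invr_gt0 // lerD // sum_other_overlaps_le.
move: h; rewrite (bigD1 j) //=.
set X := lambda' j * _ in hj *; set Y := \sum_(i | _) _ in hi *.
set Z := \sum_(i | _) _ in hi sums.
by move: sum_le sums hj; nra.
Qed.

Lemma sine_le k j (M : R) q :
  0 <= M -> (forall i r, i != j -> lambda' i * `|A r k i| <= M) ->
  M <= lambda k -> (lambda k - M) * Num.sqrt (1 - A q k j ^+ 2) <= delta.
Proof.
move=> M0 off Ml.
(* In the mode [r] of largest sine, the error terms are at most [M] times the squared sine, so one
   factor of the sine cancels. *)
case: (@arg_maxP _ _ _ q xpredT (fun r => 1 - A r k j ^+ 2) isT) => r _ rmax.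
apply: le_trans (_ : (lambda k - M) * Num.sqrt (1 - A r k j ^+ 2) <= _).
  by rewrite ler_wpM2l ?subr_ge0 // ler_wsqrtr //; apply: rmax.
have [s [_ [sr _ _]]] := two_other_modes r p2.
have sums := @weighted_prod_sum_le _ _ _ (fun q i => A q k i) lambda'
  (fun i => i != j) M r s p2 lambda'0 M0
  (fun q => abs_overlap_le1 q k) (fun q i => off i q) sr.
have rel := sine_relation k j r.
have sum_le : M * ((\sum_(i | i != j) A r k i ^+ 2
    + \sum_(i | i != j) A s k i ^+ 2) / 2) <= M * (1 - A r k j ^+ 2).
  rewrite ler_wpM2l // ler_pdivrMr // mulr_natr mulr2n lerD //.
    exact: sum_other_overlaps_le.
  apply: le_trans (sum_other_overlaps_le s k j) _; exact: rmax.
have t0 : 0 <= 1 - A r k j ^+ 2 by rewrite subr_ge0 sqr_overlap_le1.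
move: rel sum_le; have := sqr_sqrtr t0.
set S := Num.sqrt _ => <- rel sum_le.
have [->|S0] := eqVneq S 0; first by rewrite mulr0 close_ge0.
have Spos : 0 < S by rewrite lt_def S0 sqrtr_ge0.
rewrite -(ler_pM2r Spos) -mulrA -expr2 mulrBl.
by move: sums sum_le; lra.
Qed.

End Contraction.

(** * Finding the partner of a component *)

Section Matching.
Variables (R : realType) (p : nat) (d : 'I_p -> nat) (m : nat).
Variables (lambda lambda' : 'I_m -> R).
Variables (u u' : forall q : 'I_p, 'I_m -> 'rV[R]_(d q)) (delta : R).
Hypothesis p2 : (2 < p)%N.
Hypothesis uon : forall q, Defs.orthonormal (u q).
Hypothesis u'on : forall q, Defs.orthonormal (u' q).
Hypothesis lambda0 : forall k, 0 <= lambda k.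
Hypothesis lambda'0 : forall j, 0 <= lambda' j.
Hypothesis close : close_forms lambda lambda' u u' delta.

Let A q k j := dot (u q k) (u' q j).

Let A1 q k j : `|A q k j| <= 1. Proof. exact: abs_overlap_le1. Qed.

Lemma overlap_relation_absC k j q :
  lambda' j * `|A q k j| <= delta + lambda k * `|\prod_(r | r != q) A r k j|.
Proof.
rewrite /A dotC; under eq_bigr do rewrite dotC.
by apply: overlap_relation_abs => //; apply: close_formsC.
Qed.

(** If all overlaps were below 1/2, products over the other modes would be below 1/4, and
    [weight_relation] would give [lambda k <= 2 * delta + lambda k / 4], which is impossible. *)
Lemma exists_large_overlap k : 0 < lambda k -> 4 * delta <= lambda k ->
  exists j q, 1 / 2 <= `|A q k j|.
Proof.
move=> l0 dl; apply: contrapT => no.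
have small q j : `|A q k j| < 1 / 2.
  by rewrite ltNge; apply/negP => h; apply: no; exists j, q.
have delta0 : 0 <= delta by apply: close_ge0 uon close k.
have off q j : lambda' j * `|A q k j| <= delta + lambda k / 4.
  have [r [s [rq sq sr]]] := two_other_modes q p2.
  apply: le_trans (overlap_relation_absC k j q) _; rewrite lerD2l ler_wpM2l //.
  apply: le_trans (prod_le_factor2 (fun r => A1 r k j) rq sq sr) _.
  have := ltW (small r j); have := ltW (small s j).
  have := normr_ge0 (A r k j); have := normr_ge0 (A s k j); nra.
pose r : 'I_p := Ordinal (ltn_trans (isT : 0 < 2)%N p2).
have [s [_ [sr _ _]]] := two_other_modes r p2.
have M0 : 0 <= delta + lambda k / 4 by lra.
have sums := @weighted_prod_sum_le _ _ _ (fun q i => A q k i) lambda'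
  xpredT _ r s p2 lambda'0 M0 (fun q => A1 q k) (fun q i _ => off q i) sr.
have h : lambda k - \sum_j lambda' j * \prod_r A r k j <= delta.
  exact: le_trans (ler_norm _) (weight_relation p2 uon close k).
have hi : \sum_i lambda' i * \prod_q A q k i <=
    \sum_i lambda' i * `|\prod_q A q k i|.
  by apply: ler_sum => i _; rewrite ler_wpM2l // ler_norm.
have sum_le : (delta + lambda k / 4) *
    ((\sum_i A r k i ^+ 2 + \sum_i A s k i ^+ 2) / 2) <= delta + lambda k / 4.
  rewrite ler_piMr // ler_pdivrMr // mul1r.
  have : \sum_i A r k i ^+ 2 <= 1 by apply: sum_overlap_le1.
  have : \sum_i A s k i ^+ 2 <= 1 by apply: sum_overlap_le1.
  by lra.
by lra.
Qed.

Lemma large_overlap_near k j q0 (c : R) :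
  0 < lambda k -> delta <= c * lambda k -> c <= 1 / 40 ->
  1 / 2 <= `|A q0 k j| ->
  [/\ (1 - 3 * c) * lambda k <= lambda' j, lambda' j <= (1 + 2 * c) * lambda k
    & forall q, 1 - 5 * c <= `|A q k j|].
Proof.
move=> l0 dl c40; have delta0 : 0 <= delta by apply: close_ge0 uon close k.
have c0 : 0 <= c by rewrite -(pmulr_lge0 _ l0); apply: le_trans dl.
case: (@arg_maxP _ _ _ q0 xpredT (fun q => `|A q k j|) isT) => q _ qmax h0.
have h : 1 / 2 <= `|A q k j| by apply: le_trans h0 (qmax _ _).
have [r [s [rq sq sr]]] := two_other_modes q p2.
have prod_sq : `|\prod_(r | r != q) A r k j| <= `|A q k j| ^+ 2.
  apply: le_trans (prod_le_factor2 (fun r => A1 r k j) rq sq sr) _.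
  by rewrite expr2 ler_pM ?normr_ge0 //; apply: qmax.
have rel : lambda k * `|A q k j| <=
    delta + lambda' j * `|\prod_(r | r != q) A r k j|.
  exact: overlap_relation_abs.
have rel' := overlap_relation_absC k j q.
have t1 := A1 q k j.
have small_factor x : x != q -> `|\prod_(r | r != q) A r k j| <= `|A x k j|.
  by move=> xq; apply: prod_le_factor.
have P0 := normr_ge0 (\prod_(r | r != q) A r k j).
have lj0 := lambda'0 j.
move: rel rel' prod_sq small_factor P0 lj0.
set t := `|A q k j| in h t1 *; set P := `|\prod_(_ | _) _|.
set l := lambda k in l0 dl *; set l' := lambda' j.
move=> rel rel' prod_sq small_factor P0 lj0.
have lt1 : l * t <= c * l + l' * t ^+ 2.
  by apply: le_trans rel _; rewrite lerD // ler_wpM2l.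
have lt2 : l' * t <= c * l + l * t ^+ 2.
  by apply: le_trans rel' _; rewrite lerD // ler_wpM2l // ltW.
(* The first relation serves when [l' <= l], the exchanged one otherwise. *)
have quad : l * (t - t ^+ 2) <= l * c.
  have [ll|/ltW ll] := leP l' l.
    have : l' * t ^+ 2 <= l * t ^+ 2 by rewrite ler_wpM2r // sqr_ge0.
    by lra.
  have : l * t <= l' * t by rewrite ler_wpM2r //; lra.
  by lra.
rewrite ler_pM2l // in quad.
(* As [t >= 1/2], the bound [t * (1 - t) <= c] excludes values far from 1. *)
have tc : 1 - 2 * c <= t by nra.
have upper : l' <= (1 + 2 * c) * l.
  have : l' * t <= (1 + 2 * c) * l * t.
    apply: le_trans lt2 _; rewrite -subr_ge0.
    have -> : (1 + 2 * c) * l * t - (c * l + l * t ^+ 2) =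
      l * (c * (2 * t - 1) + t * (1 - t)) by ring.
    by rewrite (mulr_ge0 (ltW l0)) // addr_ge0 // mulr_ge0 //; lra.
  by rewrite ler_pM2r //; lra.
have lower : (1 - 3 * c) * l <= l'.
  have : l' * t ^+ 2 <= l' by rewrite ler_piMr // expr_le1 //; lra.
  have : (1 - 2 * c) * l <= t * l by rewrite ler_wpM2r // ltW.
  by lra.
(* All factors are at most 1 in absolute value, so a lower bound on their product bounds each of
   them. *)
have P1 : 1 - 5 * c <= P.
  rewrite leNgt; apply/negP => Pc.
  have : l' * P <= (1 + 2 * c) * l * P by rewrite ler_wpM2r.
  have : (1 - 2 * c) * l <= t * l by rewrite ler_wpM2r // ltW.
  have : (1 + 2 * c) * l * P < (1 + 2 * c) * l * (1 - 5 * c).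
    by rewrite ltr_pM2l // mulr_gt0 //; lra.
  have : 0 <= l * c ^+ 2 by rewrite mulr_ge0 ?sqr_ge0 // ltW.
  by lra.
split=> // x; have [->|xq] := eqVneq x q; first by rewrite -/t; lra.
exact: le_trans P1 (small_factor x xq).
Qed.

(** By Bessel, the squared overlaps with [i != j] are at most [s]; the product in the exchanged
    relation contains two such overlaps. *)
Lemma other_overlap_le k j (s : R) : 0 <= s ->
  (forall q, 1 - A q k j ^+ 2 <= s) ->
  forall i q, i != j -> lambda' i * `|A q k i| <= delta + lambda k * s.
Proof.
move=> s0 As i q ij; apply: le_trans (overlap_relation_absC k i q) _.
rewrite lerD2l ler_wpM2l //.
have [r [t [rq tq tr]]] := two_other_modes q p2.
apply: le_trans (prod_le_factor2 (fun r => A1 r k i) rq tq tr) _.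
have sq_le x : `|A x k i| ^+ 2 <= s.
  rewrite real_normK ?num_real //; apply: le_trans (As x).
  apply: le_trans (sum_other_overlaps_le uon u'on x k j).
  by rewrite (bigD1 i) //= lerDl sumr_ge0 // => *; apply: sqr_ge0.
have := sq_le r; have := sq_le t.
by have := sqr_ge0 (`|A r k i| - `|A t k i|); nra.
Qed.

End Matching.

(** Overlaps at least [1 - 5 * c] give squared sines at most [10 * c], so [sine_le] applies with
    [M = delta + 10 * c * lambda k], which is at most [11 * c * lambda k]. The weight bound is
    [weight_le] used in both directions. *)
Lemma component_matching (R : realType) (p : nat) (d : 'I_p -> nat) (m : nat)
    (lambda lambda' : 'I_m -> R)
    (u u' : forall q : 'I_p, 'I_m -> 'rV[R]_(d q)) (delta c : R) (k : 'I_m) :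
  (2 < p)%N ->
  (forall q, Defs.orthonormal (u q)) -> (forall q, Defs.orthonormal (u' q)) ->
  (forall k, 0 <= lambda k) -> (forall j, 0 <= lambda' j) ->
  close_forms lambda lambda' u u' delta ->
  0 < lambda k -> delta <= c * lambda k -> c <= 1 / 40 ->
  exists j, [/\ forall q, 1 / 2 < dot (u q k) (u' q j) ^+ 2,
    `|lambda k - lambda' j| <= delta
  & forall q, (1 - 11 * c) * lambda k *
      Num.sqrt (1 - dot (u q k) (u' q j) ^+ 2) <= delta].
Proof.
move=> p2 uon u'on lambda0 lambda'0 close l0 dl c40.
have delta0 : 0 <= delta by apply: close_ge0 uon close k.
have c0 : 0 <= c by rewrite -(pmulr_lge0 _ l0); apply: le_trans dl.
have cl0 : 0 <= c * lambda k by rewrite mulr_ge0 // ltW.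
have cl40 : c * lambda k <= 1 / 40 * lambda k by rewrite ler_pM2r.
have ccl : c * (c * lambda k) <= 1 / 40 * (c * lambda k) by rewrite ler_wpM2r.
have [|j [q0 Aq0]] := exists_large_overlap p2 uon u'on lambda0 lambda'0 close l0.
  lra.
have [lower upper near] := large_overlap_near p2 uon u'on lambda0 lambda'0 close
  l0 dl c40 Aq0.
have sq_near q : 1 - dot (u q k) (u' q j) ^+ 2 <= 10 * c.
  rewrite -(real_normK (num_real (dot _ _))); have := near q.
  set a := `|_| => an; suff : (1 - 5 * c) ^+ 2 <= a ^+ 2 by nra.
  by rewrite ler_sqr ?nnegrE //; lra.
have s0 : 0 <= 10 * c by lra.
have off := other_overlap_le p2 uon u'on lambda0 lambda'0 close s0 sq_near.
have close' := close_formsC close.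
have sq_near' q : 1 - dot (u' q j) (u q k) ^+ 2 <= 10 * c by rewrite dotC.
have off' := other_overlap_le p2 u'on uon lambda'0 lambda0 close' s0 sq_near'.
exists j; split=> [q||q].
- by have := sq_near q; lra.
- rewrite ler_distl lerBlDl [_ + delta]addrC; apply/andP; split.
    apply: (weight_le p2 u'on uon lambda0 close') => i q ij.
    apply: le_trans (off' i q ij) _.
    have : c * lambda' j <= c * ((1 + 2 * c) * lambda k) by rewrite ler_wpM2l.
    by lra.
  apply: (weight_le p2 uon u'on lambda'0 close) => i q ij.
  by apply: le_trans (off i q ij) _; lra.
- have M0 : 0 <= delta + lambda k * (10 * c) by lra.
  have Ml : delta + lambda k * (10 * c) <= lambda k by lra.
  have := sine_le p2 uon u'on lambda'0 close q M0 off Ml.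
  apply: le_trans; rewrite ler_wpM2r ?sqrtr_ge0 //; lra.
Qed.

(** * Assembling the permutation *)

Lemma overlap_half_inj (R : realType) (n m : nat) (v : 'I_m -> 'rV[R]_n)
    (w : 'rV[R]_n) (j k : 'I_m) :
  Defs.orthonormal v -> dot w w = 1 ->
  1 / 2 < dot (v j) w ^+ 2 -> 1 / 2 < dot (v k) w ^+ 2 -> j = k.
Proof.
move=> von w1 hj hk; apply/eqP; apply: contrapT => /negP jk.
have := bessel w von; rewrite w1 (bigD1 j) //= (bigD1 k) 1?eq_sym //=.
have : 0 <= \sum_(i | (i != j) && (i != k)) dot (v i) w ^+ 2.
  by apply: sumr_ge0 => *; apply: sqr_ge0.
by lra.
Qed.

(** [M] is the graph of a partial injection, which extends to a permutation; the default value [k]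
    of [f] is taken only outside its domain [D]. *)
Lemma permutation_of_matching (m : nat) (M : 'I_m -> 'I_m -> Prop) :
  (forall k i j, M k i -> M k j -> i = j) ->
  (forall k l j, M k j -> M l j -> k = l) ->
  exists s : 'S_m, forall k j, M k j -> s k = j.
Proof.
move=> Mfun Minj; pose f k := odflt k [pick j | `[< M k j >]].
have fE k j : M k j -> f k = j.
  move=> Mkj; rewrite /f; case: pickP => [i /asboolP Mki|/(_ j)] /=.
    exact: Mfun Mki Mkj.
  by case/asboolP.
pose D := [seq k <- enum 'I_m | [exists j, `[< M k j >]]].
have DP k : reflect (exists j, M k j) (k \in D).
  rewrite mem_filter mem_enum andbT.
  by apply: (iffP existsP) => -[j /asboolP]; exists j.
have [|s sf] := @inj_in_extend_perm _ f D.
  move=> k l /DP [i Mki] /DP [j Mlj]; rewrite (fE _ _ Mki) (fE _ _ Mlj) => ij.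
  by move: Mki; rewrite ij => Mkj; apply: Minj Mkj Mlj.
exists s => k j Mkj; rewrite sf; first exact: fE.
by apply/DP; exists j.
Qed.

Lemma odeco_close_forms (R : realType) (p : nat) (d : 'I_p -> nat)
    (T T' : tensor R d) (lambda lambda' : 'I_(dmin d) -> R)
    (u u' : forall q : 'I_p, 'I_(dmin d) -> 'rV[R]_(d q)) :
  (0 < p)%N -> odeco_decomposition T lambda u ->
  odeco_decomposition T' lambda' u' ->
  close_forms lambda lambda' u u' (spectral_norm (T' - T)).
Proof.
move=> p0 [_ _ _ TE] [_ _ _ T'E] x x1; rewrite distrC -!tdot_sum_outer.
by rewrite -TE -T'E -tdotBl abs_tdot_le_spectral_norm.
Qed.

Theorem theorem2p5 (R : realType) :
  exists c : R -> R,
    (forall eps : R, 0 < eps -> 0 < c eps) /\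
    forall (p : nat) (d : 'I_p -> nat),
      (2 < p)%N -> (forall q : 'I_p, (1 <= d q)%N) ->
    forall (T T' : tensor R d) (lambda lambda' : 'I_(dmin d) -> R)
      (u u' : forall q : 'I_p, 'I_(dmin d) -> 'rV[R]_(d q)),
      odeco_decomposition T lambda u ->
      odeco_decomposition T' lambda' u' ->
    exists pi : 'S_(dmin d),
      forall (eps : R) (k : 'I_(dmin d)),
        0 < eps ->
        spectral_norm (T' - T) <= c eps * lambda k ->
        `|lambda k - lambda' (pi k)| <= spectral_norm (T' - T) /\
        (lambda k != 0 ->
         \big[Num.max/0]_(q < p) sin (line_angle (u q k) (u' q (pi k)))
           <= (1 + eps) * spectral_norm (T' - T) / lambda k).
Proof.
(* This choice keeps [c eps] below 1/40 and makes [(1 + eps) * (1 - 11 * c eps) = 1 + eps - 11 / 40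
   * eps] at least 1. *)
exists (fun eps => eps / (40 * (1 + eps))); split=> [eps eps0|].
  by rewrite divr_gt0 // mulr_gt0 //; lra.
move=> p d p2 _ T T' lambda lambda' u u' decT decT'.
have close := odeco_close_forms (ltnW (ltnW p2)) decT decT'.
have close' := close_formsC close.
have [_ lambda0 uon _] := decT; have [_ lambda'0 u'on _] := decT'.
set delta := spectral_norm _ in close close' *.
pose q0 : 'I_p := Ordinal (ltnW (ltnW p2)).
(* The matching relation involves neither [eps] nor [delta], so one permutation serves all [eps] and
   [k]; a single mode suffices to identify the partner. *)
have [||pi piE] := @permutation_of_matching _
  (fun k j => 1 / 2 < dot (u q0 k) (u' q0 j) ^+ 2).
- move=> k i j; rewrite !(dotC (u q0 k)); apply: overlap_half_inj => //.
  by rewrite uon eqxx.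
- by move=> k l j; apply: overlap_half_inj => //; rewrite u'on eqxx.
exists pi => eps k eps0 dl.
have delta0 : 0 <= delta by apply: close_ge0 uon close k.
have [lk0|lk0] := eqVneq (lambda k) 0; last first.
  have lk : 0 < lambda k by rewrite lt_def lk0 lambda0.
  pose c := eps / (40 * (1 + eps)).
  have cE : c * (40 * (1 + eps)) = eps by rewrite /c divfK //; lra.
  have c40 : c <= 1 / 40 by rewrite ler_pdivrMr; lra.
  have [j [Mj dj sj]] :=
    component_matching p2 uon u'on lambda0 lambda'0 close lk dl c40.
  rewrite (piE k j (Mj q0)); split=> // _.
  (* Needed because the maximum starts from 0. *)
  have rhs0 : 0 <= (1 + eps) * delta / lambda k.
    by rewrite divr_ge0 // mulr_ge0 //; lra.
  apply: bigmax_le => // q _.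
  rewrite sin_line_angle; first last.
  - by apply/enorm1P; rewrite u'on eqxx.
  - by apply/enorm1P; rewrite uon eqxx.
  rewrite ler_pdivlMr //; set s := Num.sqrt _.
  have sl0 : 0 <= s * lambda k by rewrite mulr_ge0 ?sqrtr_ge0.
  have h : (1 + eps) * ((1 - 11 * c) * lambda k * s) <= (1 + eps) * delta.
    by rewrite ler_pM2l ?sj //; lra.
  apply: le_trans h; rewrite -subr_ge0.
  have -> : (1 + eps) * ((1 - 11 * c) * lambda k * s) - s * lambda k =
      (s * lambda k) * (eps - 11 / 40 * (c * (40 * (1 + eps)))) by field.
  by rewrite cE mulr_ge0 //; lra.
split=> //.
(* Here delta = 0, and a nonzero lambda' (pi k) would be matched, with the roles
   of T and T' exchanged, to an equal lambda i with pi i = pi k. *)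
rewrite lk0 mulr0 in dl.
have {}delta0 : delta = 0 by apply/eqP; rewrite eq_le dl.
have [l'0|l'0] := eqVneq (lambda' (pi k)) 0.
  by rewrite lk0 l'0 subrr normr0 delta0.
have l' : 0 < lambda' (pi k) by rewrite lt_def l'0 lambda'0.
have dl' : delta <= 0 * lambda' (pi k) by rewrite mul0r.
have c40 : 0 <= 1 / 40 :> R by lra.
have [i [Mi di _]] :=
  component_matching p2 u'on uon lambda'0 lambda0 close' l' dl' c40.
have /perm_inj ik : pi i = pi k by apply: piE; rewrite dotC.
by rewrite distrC; rewrite ik in di.
Qed.
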